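(* There exists an infinite set $A = \{a_1 < a_2 < \cdots\}$ of positive integers such that $a_n = n^3 + O(n^{2.5}\log n)$ as $n \to \infty$ and $s_A < \infty$.
   Context: For an infinite set $A = \{a_1 < a_2 < \cdots\}$ of nonnegative integers, $R_A(n)$ is the number of pairs $(i,j)$ with $i \le j$ and $a_i + a_j = n$; $s_A(x) = \max_{n \le x} R_A(n)$ and $s_A = \lim_{x\to\infty} s_A(x)$, which may be infinite. *)

(* Defs.v *)
From mathcomp Require Export all_boot all_order all_algebra.
From mathcomp Require Export finmap.
From mathcomp Require Export all_classical all_reals all_analysis.
Export Order.TTheory GRing.Theory Num.Theory.
Export numFieldNormedType.Exports.

Set Implicit Arguments.
Unset Strict Implicit.
Unset Printing Implicit Defensive.

Local Open Scope classical_set_scope.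
Local Open Scope nat_scope.

(** Sequences are indexed from 1: [a 1 < a 2 < ...] lists the elements of [A],
    and the value [a 0] plays no role. *)
Definition increasing_enumeration (A : set nat) (a : nat -> nat) : Prop :=
  (forall i j, 0 < i -> i < j -> a i < a j) /\
  a @` [set i | 0 < i] = A.

(** [R_A(n)], where [A] is given by its increasing enumeration [a].  The set of
    pairs is then finite, so [fset_set] does not take its default value. *)
Definition repr_count (a : nat -> nat) (n : nat) : nat :=
  #|` fset_set [set ij : nat * nat |
       [/\ 0 < ij.1, ij.1 <= ij.2 & a ij.1 + a ij.2 = n] ]|.

(** [s_A(x)] for real [x >= 0]; the integers [n <= x] are those with
    [n <= truncn x]. *)
Definition repr_max (R : realType) (a : nat -> nat) (x : R) : nat :=
  \max_(n < (Num.truncn x).+1) repr_count a n.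

(** The limit exists in [\bar R] because [repr_max a] is nondecreasing. *)
Definition repr_sup (R : realType) (a : nat -> nat) : \bar R :=
  lim (((repr_max a x)%:R : R)%:E @[x --> (+oo : set_system R)])%R.

(* Main.v *)
Require Import Defs.
From mathcomp Require Import zify lra.

(** Choose the terms greedily, with [a n] in the window [[n^3, n^3 + n^2]], so
    that after every step no integer is a sum [a i + a j] with [i < j] in more
    than two ways.  Windows of consecutive cubes do not overlap, so [a] is
    increasing and [a n = n^3 + O(n^2)], which is within the required error.
    The diagonal pairs [(i, i)] add at most one representation of each integer,
    so [R_A <= 3] everywhere.

    The point is that the window always contains an admissible value.  Adding
    [x] to [a 0, ..., a (n-1)] creates at most one new representation of a given
    integer, and it does harm only if some [x + a k] with [k < n] already has
    two.  Such a bad [x] therefore arises from at least two triples [(i, j, k)]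
    with [x = a i + a j - a k].  Fix [i] and [k]: as [x] runs over the window,
    [a j] is confined to an interval of length [n^2], while [i < j] and
    [a i + a j >= n^3] make [j] at least about [n / 2], where terms two apart
    differ by more than [n^2] ([window_sep]).  Hence at most two values of [j],
    of opposite parity, are possible; there are at most [2 n^2] triples in all,
    so at most [n^2] bad values among the [n^2 + 1] integers of the window
    ([good_shift]). *)

Set Implicit Arguments.
Unset Strict Implicit.
Unset Printing Implicit Defensive.

Local Open Scope nat_scope.

(** * Counting representations *)

(** Written as a sum over the larger index, so that lengthening the prefix by
    one term adds one inner sum. *)
Definition strict_reps (a : nat -> nat) (n N : nat) : nat :=
  \sum_(j < n) \sum_(i < j) (a i + a j == N).

(** The window of index 0 is [{0}]; starting there instead of at 1 spares a
    shift of indices, and an additional term can only raise the counts. *)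
Definition greedy_prefix (n : nat) (a : nat -> nat) : Prop :=
  (forall i, i < n -> i ^ 3 <= a i <= i ^ 3 + i ^ 2) /\
  (forall N, strict_reps a n N <= 2).

Lemma sum_bool_card (T : finType) (P : pred T) : \sum_(t : T) P t = #|P|.
Proof.
rewrite -sum1_card (big_mkcond (mem P)) /=; apply: eq_bigr => t _.
by rewrite unfold_in; case: (P t).
Qed.

Lemma sum_eq_le1 n (f : nat -> nat) (N : nat) :
  (forall i j, i < j -> j < n -> f i != f j) -> \sum_(i < n) (f i == N) <= 1.
Proof.
move=> finj; rewrite sum_bool_card; apply/card_le1_eqP => i j.
rewrite !unfold_in => /eqP fi /eqP fj; apply: val_inj.
case: (ltngtP i j) => // [ij|ji].
  by have := finj _ _ ij (ltn_ord j); rewrite fi fj eqxx.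
by have := finj _ _ ji (ltn_ord i); rewrite fi fj eqxx.
Qed.

Lemma strict_reps_card a n N :
  strict_reps a n N =
  #|[pred p : 'I_n * 'I_n | (p.1 < p.2) && (a p.1 + a p.2 == N)]|.
Proof.
rewrite -sum_bool_card -(pair_bigA _ (fun i j : 'I_n =>
  nat_of_bool ((i < j) && (a i + a j == N)))) /= exchange_big /=.
apply: eq_bigr => j _.
rewrite (big_ord_widen n (fun i => nat_of_bool (a i + a j == N))); last first.
  exact: ltnW.
by rewrite big_mkcond; apply: eq_bigr => i _; case: (i < j).
Qed.

(** * Separation of the windows *)

Lemma window_lt a i j : i < j -> a i <= i ^ 3 + i ^ 2 -> j ^ 3 <= a j ->
  a i < a j.
Proof.
move=> ij ai aj; have := leq_exp2r i.+1 j (isT : 0 < 3).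
rewrite ij; nia.
Qed.

(** Since [2 (j^3 + j^2) < (2 j + 2)^3], the pair [i < j] can reach [n^3] only
    if [n <= 2 j + 1]; and [(j + 2)^3 - (j^3 + j^2)] exceeds [(2 j + 1)^2]. *)
Lemma window_sep a n i j k :
  (forall l, l < n -> l ^ 3 <= a l <= l ^ 3 + l ^ 2) ->
  i < j -> j.+2 <= k -> k < n -> n ^ 3 <= a i + a j -> a j + n ^ 2 < a k.
Proof.
move=> win ij jk kn big; have jn : j < n by lia.
have /andP[_ ai] := win _ (ltn_trans ij jn); have /andP[_ aj] := win _ jn.
have /andP[ak _] := win _ kn.
have i3 : i ^ 3 <= j ^ 3 by rewrite leq_exp2r // ltnW.
have i2 : i ^ 2 <= j ^ 2 by rewrite leq_exp2r // ltnW.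
have nj : n <= j.*2.+1.
  rewrite leqNgt; apply/negP => nj.
  have : j.*2.+2 ^ 3 <= n ^ 3 by rewrite leq_exp2r.
  nia.
have n2 : n ^ 2 <= j.*2.+1 ^ 2 by rewrite leq_exp2r.
have k3 : j.+2 ^ 3 <= k ^ 3 by rewrite leq_exp2r.
have e3 : j.+2 ^ 3 = j ^ 3 + 6 * j ^ 2 + 12 * j + 8 by lia.
have e2 : j.*2.+1 ^ 2 = 4 * j ^ 2 + 4 * j + 1 by lia.
rewrite e3 in k3; rewrite e2 in n2; lia.
Qed.

(** * The greedy step *)

(** Double counting: were every shift [d] bad, with witness [kappa d], the
    triples [(d, i, j)] with [a i + a j = a (kappa d) + n^3 + d] would number at
    least [2 (n^2 + 1)].  But [i], [kappa d] and the parity of [j] determine the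
    triple, which leaves room for [2 n^2] only. *)
Lemma good_shift n a : greedy_prefix n a ->
  exists2 d, d <= n ^ 2 &
    forall k, k < n -> strict_reps a n (a k + (n ^ 3 + d)) <= 1.
Proof.
move=> [win _].
suff [d dP] : exists d : 'I_(n ^ 2).+1,
    forall k : 'I_n, strict_reps a n (a k + (n ^ 3 + d)) <= 1.
  exists d => [|k kn]; first by rewrite -ltnS.
  exact: (dP (Ordinal kn)).
apply: contrapT => /forallNP nod.
have /choice[kappa kappaP] : forall d : 'I_(n ^ 2).+1, exists k : 'I_n,
    1 < strict_reps a n (a k + (n ^ 3 + d)).
  by move=> d; have /existsNP[k /negP] := nod d; rewrite -ltnNge; exists k.
pose T := [pred t : 'I_(n ^ 2).+1 * ('I_n * 'I_n) |
  (t.2.1 < t.2.2) && (a t.2.1 + a t.2.2 == a (kappa t.1) + (n ^ 3 + t.1))].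
have Tge : (n ^ 2).+1 * 2 <= #|T|.
  rewrite -sum_bool_card -(pair_bigA _ (fun d p => nat_of_bool (T (d, p)))) /=.
  rewrite -[leqLHS]/((n ^ 2).+1 * 2) -[X in X * 2]card_ord -sum_nat_const.
  apply: leq_sum => d _; apply: leq_trans (kappaP d) _.
  by rewrite strict_reps_card -sum_bool_card.
pose code (t : 'I_(n ^ 2).+1 * ('I_n * 'I_n)) := (t.2.1, kappa t.1, odd t.2.2).
have code_inj : {in T &, injective code}.
  move=> [d [i j]] [d' [i' j']]; rewrite !unfold_in /=.
  move=> /andP[ij /eqP e] /andP[ij' /eqP e'] [ii kk jj].
  rewrite -{}kk -{}ii in ij' e' *.
  have dn := ltn_ord d; have dn' := ltn_ord d'.
  have ejj : j = j'.
    apply: val_inj => /=; case: (ltngtP j j') => // [lt|lt].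
      have lt2 : j.+2 <= j' by lia.
      have := window_sep win ij lt2 (ltn_ord j').
      lia.
    have lt2 : j'.+2 <= j by lia.
    have := window_sep win ij' lt2 (ltn_ord j).
    lia.
  by rewrite -ejj in e' *; congr pair; apply: val_inj => /=; lia.
have : #|T| <= #|{: 'I_n * 'I_n * bool}|.
  rewrite -(card_in_imset code_inj); exact: max_card.
rewrite !card_prod !card_ord card_bool; nia.
Qed.

Lemma eq_strict_reps n f g : (forall i, i < n -> f i = g i) ->
  strict_reps f n =1 strict_reps g n.
Proof.
move=> fg N; apply: eq_bigr => j _; apply: eq_bigr => i _.
by rewrite !fg // (ltn_trans _ (ltn_ord j)).
Qed.

Lemma eq_greedy_prefix n f g : (forall i, i < n -> f i = g i) ->
  greedy_prefix n f -> greedy_prefix n g.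
Proof.
move=> fg [win rep]; split => [i ni|N]; first by rewrite -fg ?win.
by rewrite -(eq_strict_reps fg).
Qed.

Lemma greedy_step n f : greedy_prefix n f ->
  exists x, greedy_prefix n.+1 (fun i => if i == n then x else f i).
Proof.
move=> fP; have [win rep] := fP; have [d dn dP] := good_shift fP.
exists (n ^ 3 + d); set g := fun i => _.
have gf i : i < n -> g i = f i by move=> ni; rewrite /g ltn_eqF.
have gn : g n = n ^ 3 + d by rewrite /g eqxx.
split=> [i|N].
  rewrite ltnS leq_eqVlt => /orP[/eqP->|ni]; last by rewrite gf ?win.
  by rewrite gn leq_addr leq_add2l.
rewrite /strict_reps big_ord_recr /= -/(strict_reps g n N).
rewrite (eq_strict_reps gf) gn.
have [|[k kn eN]] : (forall k, k < n -> g k + (n ^ 3 + d) != N) \/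
    exists2 k, k < n & g k + (n ^ 3 + d) = N.
  case: (pselect (exists2 k, k < n & g k + (n ^ 3 + d) = N)); first by right.
  by move=> H; left=> k kn; apply/eqP => E; apply: H; exists k.
- move=> H; rewrite [X in _ + X]big1 ?addn0 ?rep // => i _.
  by rewrite (negbTE (H _ _)).
  (* [N] gains a representation, but [good_shift] gave it at most one so far. *)
- have -> : 2 = 1 + 1 by []; apply: leq_add.
    by rewrite -eN gf // dP.
  apply: (@sum_eq_le1 n (fun i => g i + (n ^ 3 + d))) => i j ij jn.
  rewrite eqn_add2r ltn_eqF // !gf ?(ltn_trans ij) //.
  have /andP[_ ui] := win _ (ltn_trans ij jn); have /andP[lj _] := win _ jn.
  exact: window_lt ui lj.
Qed.

(** * The infinite sequence *)

(** Dependent choice for sequences whose property is tested on prefixes: no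
    stage alters an earlier value, so the diagonal of the successive prefixes
    agrees with each of them. *)
Lemma prefixwise_choice (T : Type) (P : nat -> (nat -> T) -> Prop) :
  (forall n f g, (forall i, i < n -> f i = g i) -> P n f -> P n g) ->
  (exists f, P 0 f) ->
  (forall n f, P n f -> exists x, P n.+1 (fun i => if i == n then x else f i)) ->
  exists a, forall n, P n a.
Proof.
move=> Pext [f0 Pf0] Pstep.
have /choice[X XP] : forall nf : nat * (nat -> T), exists x, P nf.1 nf.2 ->
    P nf.1.+1 (fun i => if i == nf.1 then x else nf.2 i).
  move=> [n f] /=; have [/Pstep[x Px]|nP] := pselect (P n f); first by exists x.
  by exists (f 0).
pose F := fix F n := if n is m.+1
  then fun i => if i == m then X (m, F m) else F m i else f0.
have FP n : P n (F n) by elim: n => [|n IH] //=; exact: (XP (n, F n)).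
have Fstable i m : F (i.+1 + m) i = F i.+1 i.
  elim: m => [|m IH]; first by rewrite addn0.
  by rewrite addnS -IH [LHS]/= ifN_eq //; lia.
exists (fun i => F i.+1 i) => n; apply: Pext (FP n) => i ni.
by rewrite -(subnKC ni) Fstable.
Qed.

Lemma greedy_sequence : exists a, forall n, greedy_prefix n a.
Proof.
apply: prefixwise_choice; [exact: eq_greedy_prefix| |exact: greedy_step].
exists (fun=> 0); split => // N; by rewrite /strict_reps big_ord0.
Qed.

(** The additional unit pays for the diagonal pairs, and indices up to [n]
    suffice because [i <= a i]. *)
Lemma repr_count_le a n : (forall i, i ^ 3 <= a i <= i ^ 3 + i ^ 2) ->
  repr_count a n <= (strict_reps a n.+1 n).+1.
Proof.
move=> win.
have age i : i <= a i by have /andP[+ _] := win i; nia.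
have alt i j : i < j -> a i < a j.
  move=> ij; have /andP[_ ui] := win i; have /andP[lj _] := win j.
  exact: window_lt ui lj.
have X_bnd i j : i <= j -> a i + a j = n -> i < n.+1 /\ j < n.+1.
  by move=> ij eij; have := age i; have := age j; lia.
pose D := [pred p : 'I_n.+1 * 'I_n.+1 | (p.1 < p.2) && (a p.1 + a p.2 == n)].
pose E := [pred i : 'I_n.+1 | a i + a i == n].
apply: (@leq_trans (size
  ([seq (val p.1, val p.2) | p <- enum D] ++
   [seq (val i, val i) | i <- enum E]))).
  apply: uniq_leq_size; first exact: fset_uniq.
  move=> [i j] ijX.
  have [/= i0 ij eij] : [set ij : nat * nat |
       [/\ 0 < ij.1, ij.1 <= ij.2 & a ij.1 + a ij.2 = n] ]%classic (i, j).
    apply: set_mem; rewrite -in_fset_set //.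
    apply: (@sub_finite_set _ _ (`I_n.+1 `*` `I_n.+1)%classic).
      by move=> [k l] /= [_ kl ekl]; have [] := X_bnd _ _ kl ekl.
    by apply: finite_setX; exact: finite_II.
  have [ni nj] := X_bnd _ _ ij eij.
  rewrite mem_cat; move: ij; rewrite leq_eqVlt => /orP[/eqP ij|ij]; apply/orP.
    right; apply/mapP; exists (Ordinal ni); rewrite /= ?ij //.
    by rewrite mem_enum unfold_in /= {2}ij eij.
  left; apply/mapP; exists (Ordinal ni, Ordinal nj) => //=.
  by rewrite mem_enum unfold_in /= ij eij eqxx.
rewrite size_cat !size_map -!cardE -strict_reps_card -[leqRHS]addn1 leq_add2l.
rewrite -sum_bool_card; apply: (@sum_eq_le1 n.+1 (fun i => a i + a i)).
by move=> i j ij _; have := alt _ _ ij; lia.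
Qed.


(** * Asymptotics *)

Local Open Scope classical_set_scope.
Local Open Scope ring_scope.

Lemma bounded_nondecreasing_stationary (M : nat -> nat) (B : nat) :
  {homo M : k l / (k <= l)%N} -> (forall k, (M k <= B)%N) ->
  exists k0, forall k, (k0 <= k)%N -> M k = M k0.
Proof.
move=> Mmono MB.
have ex : exists v, `[< exists k, M k = v >].
  by exists (M 0%N); apply/asboolP; exists 0%N.
have bd v : `[< exists k, M k = v >] -> (v <= B)%N.
  by move=> /asboolP[k <-].
case: (ex_maxnP ex bd) => v /asboolP[k0 Mk0] vmax.
exists k0 => k k0k; apply/eqP; rewrite eqn_leq (Mmono _ _ k0k) andbT Mk0.
by apply: vmax; apply/asboolP; exists k.
Qed.

(** The limit is that of an eventually constant function, so it is attained
    and finite. *)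
Lemma repr_sup_fin (R : realType) (a : nat -> nat) (B : nat) :
  (forall n, (repr_count a n <= B)%N) -> (repr_sup R a < +oo)%E.
Proof.
move=> cB; pose M k := (\max_(n < k.+1) repr_count a n)%N.
have [k0 Mk0] : exists k0, forall k, (k0 <= k)%N -> M k = M k0.
  apply: (@bounded_nondecreasing_stationary M B) => [k l kl|k].
    apply/bigmax_leqP => n _.
    have nl : (n < l.+1)%N := leq_trans (ltn_ord n) (kl : (k < l.+1)%N).
    exact: (leq_bigmax (Ordinal nl)).
  by apply/bigmax_leqP.
rewrite /repr_sup (@lim_near_cst _ (@ereal_hausdorff R) _ _ _ (M k0)%:R%:E).
  by rewrite ltry.
near=> x; congr (_%:R%:E); apply: Mk0.
rewrite truncn_ge_nat; near: x; apply: nbhs_pinfty_ge; exact: num_real.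
Unshelve. all: by end_near. Qed.

Theorem theorem9 (R : realType) :
  exists (A : set nat) (a : nat -> nat),
    [/\ infinite_set A,
        (forall m : nat, A m -> (0 < m)%N),
        increasing_enumeration A a,
        (fun n : nat => (a n)%:R : R^o) =
          (fun n : nat => (n%:R : R) ^+ 3 : R^o) +O_\oo
          (fun n : nat => (n%:R : R) `^ (5 / 2) * ln (n%:R : R) : R^o)
      & (repr_sup R a < +oo)%E].
Proof.
have [a aP] := greedy_sequence.
have win i : (i ^ 3 <= a i <= i ^ 3 + i ^ 2)%N by have [+ _] := aP i.+1; exact.
have incr i j : (i < j)%N -> (a i < a j)%N.
  move=> ij; have /andP[_ ui] := win i; have /andP[lj _] := win j.
  exact: window_lt ui lj.
exists (a @` [set i | (0 < i)%N]), a; split.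
- move=> /finite_seqP[s As].
  pose m := (\max_(x <- s) x).+1.
  have : (a @` [set i | (0 < i)%N]) (a m) by exists m.
  rewrite As /= => ms.
  have := leq_bigmax_seq (P := xpredT) (F := id) (a m) ms isT.
  by have /andP[+ _] := win m; rewrite /m /=; nia.
- move=> _ [i /= i0 <-]; have /andP[+ _] := win i; apply: leq_trans.
  by rewrite expn_gt0 i0.
- by split=> // i j _; exact: incr.
  (* Any constant [k >= 1 / ln 2] works: [ln n >= ln 2] and [n^2 <= n^(5/2)]. *)
- apply/eqaddOP; near=> k; near=> n.
  have n2 : (2 <= n)%N by near: n; exact: nbhs_infty_ge.
  have ln2 : 0 < ln (2 : R) by rewrite ln_gt0 // ltr1n.
  have kln : 1 <= k * ln (2 : R).
    rewrite -ler_pdivrMr // mul1r; near: k; apply: nbhs_pinfty_ge.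
  have k0 : 0 <= k by rewrite -(pmulr_lge0 _ ln2) (le_trans _ kln).
  rewrite /= -[leLHS]/(`|(a n)%:R - (n%:R : R) ^+ 3|).
  have /andP[lo up] := win n.
  rewrite -natrX -natrB // normr_nat.
  apply: (@le_trans _ _ ((n%:R : R) ^+ 2)).
    by rewrite -natrX ler_nat leq_subLR.
  have n1 : 1 <= (n%:R : R) by rewrite ler1n; lia.
  have lnn : ln (2 : R) <= ln (n%:R : R).
    by rewrite ler_ln ?posrE ?ltr0n ?ler_nat //; lia.
  rewrite ger0_norm; last first.
    by rewrite mulr_ge0 ?powR_ge0 // (le_trans (ltW ln2)).
  rewrite mulrCA -[leLHS]mulr1; apply: ler_pM => //.
    by rewrite -powR_mulrn ?(le_trans _ n1) //; apply: ler_powR => //; lra.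
  by apply: le_trans kln _; rewrite ler_wpM2l.
- apply: (@repr_sup_fin R a 3) => n; apply: leq_trans (repr_count_le n win) _.
  by have [_ +] := aP n.+1; exact.
Unshelve. all: by end_near. Qed.
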